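(* For every constant $\varepsilon > 0$, no (possibly randomized) online algorithm that uses no preemption is $(1/4+\varepsilon)$-competitive for online unconstrained submodular maximization, even if the objective function $f$ is guaranteed to be the cut function of a weighted directed graph.
   Context: Online unconstrained submodular maximization: there is an unknown finite ground set $\mathcal N=\{u_1,\dots,u_n\}$ and a non-negative submodular function $f:2^{\mathcal N}\to\mathbb R_{\ge 0}$. The elements are revealed one by one in the order $u_1,u_2,\dots,u_n$, chosen by an adversary. The algorithm does not know $n$ in advance. The algorithm maintains solutions $S_0=\varnothing,S_1,\dots,S_n$, where $S_i\subseteq S_{i-1}\cup\{u_i\}$ is chosen (possibly at random) immediately after $u_i$ is revealed, using only the values of $f$ on subsets of $\mathcal N_i=\{u_1,\dots,u_i\}$ (accessed through a value oracle), the past, and internal randomness. There is no restriction on the computational power of the algorithm. Every subset of $\mathcal N$ is feasible. The algorithm uses no preemption if it never removes an accepted element, i.e. $S_{i-1}\subseteq S_i$ for every $i$ (so $S_i\in\{S_{i-1},S_{i-1}\cup\{u_i\}\}$). The algorithm is $\alpha$-competitive if $\mathbb E[f(S_n)]\ge \alpha\cdot\max_{S\subseteq\mathcal N}f(S)$ for every instance. The cut function of a directed graph with vertex set $\mathcal N$ and non-negative arc weights is $f(S)=$ the total weight of arcs going from a vertex of $S$ to a vertex of $\mathcal N\setminus S$. *)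

(* Defs.v *)
From HB Require Import structures.
From mathcomp Require Import all_boot all_order all_algebra.
From mathcomp Require Import all_classical all_reals all_analysis.

Set Implicit Arguments.
Unset Strict Implicit.
Unset Printing Implicit Defensive.

Import Order.TTheory GRing.Theory Num.Theory.

Local Open Scope ring_scope.

(** The ground set of an instance with [n] elements is ['I_n], numbered in order
    of arrival: [k : 'I_n] is u_(k+1), and N_i is ['I_i].  Since an
    instance is an arbitrary objective on ['I_n], this covers every arrival
    order. *)

(** The set [A] seen inside ['I_n], elements being identified by their arrival
    rank; it is only used for [m <= n], where it is the inclusion of N_m in
    N_n. *)
Definition embed (m n : nat) (A : {set 'I_m}) : {set 'I_n} :=
  [set x : 'I_n | [exists y : 'I_m, (y \in A) && (val y == val x)]].

(** The values of [f] on the subsets of N_i (for [i <= n]). *)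
Definition prefix_values (R : realType) (n : nat) (f : {ffun {set 'I_n} -> R})
    (i : nat) : {ffun {set 'I_i} -> R} :=
  [ffun A : {set 'I_i} => f (embed n A)].

Definition nonneg_submodular (R : realType) (n : nat)
    (f : {ffun {set 'I_n} -> R}) : Prop :=
  (forall A, 0 <= f A) /\
  (forall A B, f (A :|: B) + f (A :&: B) <= f A + f B).

Definition dicut (R : realType) (n : nat) (w : 'I_n -> 'I_n -> R) :
    {ffun {set 'I_n} -> R} :=
  [ffun S : {set 'I_n} => \sum_(u in S) \sum_(v in ~: S) w u v].

Definition is_dicut (R : realType) (n : nat)
    (f : {ffun {set 'I_n} -> R}) : Prop :=
  exists w : 'I_n -> 'I_n -> R, (forall u v, 0 <= w u v) /\ f = dicut w.

(** [step i g S omega] is the solution S_(i+1) chosen when the (i+1)-st element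
    ([ord_max : 'I_i.+1]) is revealed, where [g] lists the values of the
    objective on all subsets of N_(i+1), [S] is the previous solution S_i and
    [omega] is the outcome of the internal randomness.  The total number of
    elements is not an input.  Nothing of the past is lost: earlier oracle
    answers are restrictions of [g], and earlier solutions are determined by
    these and [omega].  The algorithm need not be computable. *)
Record online_algorithm (R : realType) (d : measure_display)
    (Omega : measurableType d) := OnlineAlgorithm {
  step : forall i : nat,
    {ffun {set 'I_i.+1} -> R} -> {set 'I_i} -> Omega -> {set 'I_i.+1};
  step_sub : forall i g S omega,
    step (i := i) g S omega \subset embed i.+1 S :|: [set ord_max];
  step_measurable : forall i g S T,
    measurable ([set omega | step (i := i) g S omega = T]%classic : set Omega)
}.

(** The solution S_i after [i] arrivals (meaningful for [i <= n]). *)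
Fixpoint solution (R : realType) (d : measure_display)
    (Omega : measurableType d) (alg : online_algorithm R Omega)
    (n : nat) (f : {ffun {set 'I_n} -> R}) (omega : Omega) (i : nat) :
    {set 'I_i} :=
  match i with
  | 0 => finset.set0
  | j.+1 => step alg (prefix_values f j.+1) (solution alg f omega j) omega
  end.

(** In the next two definitions, [C] is the class of objectives to which the
    input is guaranteed to belong. *)
Definition no_preemption (R : realType) (d : measure_display)
    (Omega : measurableType d) (C : forall n, {ffun {set 'I_n} -> R} -> Prop)
    (alg : online_algorithm R Omega) : Prop :=
  forall (n : nat) (f : {ffun {set 'I_n} -> R}), C n f ->
  forall (omega : Omega) (i : nat), (i < n)%N ->
    embed i.+1 (solution alg f omega i) \subset solution alg f omega i.+1.

Definition competitive (R : realType) (d : measure_display)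
    (Omega : measurableType d) (P : probability Omega R)
    (C : forall n, {ffun {set 'I_n} -> R} -> Prop)
    (alpha : R) (alg : online_algorithm R Omega) : Prop :=
  forall (n : nat) (f : {ffun {set 'I_n} -> R}), C n f ->
    ((alpha * \big[Num.max/f finset.set0]_(S : {set 'I_n}) f S)%:E
       <= 'E_P[fun omega => f (solution alg f omega n)])%E.

(* Main.v *)
(* Number the elements from 0.  For large W, let u_k (k >= 1) have total
   out-weight W^k, spread evenly over the k elements that arrived before it.
   Every prefix of this instance is an instance of the same kind, so without
   preemption the run on each prefix is determined by one sequence of
   accept/reject decisions.  Up to a small fraction of W^k the value after the
   arrival of u_k is W^k y_k if u_k is accepted and 0 otherwise, y_k being the
   fraction of the earlier elements that were rejected, while the optimum is at
   least W^k.  Averaged with the weights 1/(k+1), these ratios are at most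
   1/4 + O(1/log n) for every sequence of decisions, hence also in
   expectation. *)

Require Import Defs.
From HB Require Import structures.
From mathcomp Require Import all_boot all_order all_algebra.
From mathcomp Require Import all_classical all_reals all_analysis.
From mathcomp Require Import measurable_realfun ring lra.

Set Implicit Arguments.
Unset Strict Implicit.
Unset Printing Implicit Defensive.

Import Order.TTheory GRing.Theory Num.Theory.

Local Open Scope ring_scope.

(** * Directed cuts are submodular *)

Lemma is_dicut_nonneg_submodular (R : realType) (n : nat)
    (f : {ffun {set 'I_n} -> R}) : is_dicut f -> nonneg_submodular f.
Proof.
move=> [w [w0 ->]]; split=> [A|A B].
  by rewrite ffunE; apply: sumr_ge0 => u _; apply: sumr_ge0.
(* Summing over all ordered pairs reduces submodularity to one inequality per arc, decided by the
   memberships of its two ends. *)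
have E (S : {set 'I_n}) : dicut w S =
    \sum_u \sum_v (if (u \in S) && (v \notin S) then w u v else 0).
  rewrite ffunE big_mkcond /=; apply: eq_bigr => u _.
  case: (u \in S) => /=; last by rewrite big1.
  by rewrite big_mkcond; apply: eq_bigr => v _; rewrite inE.
rewrite !E -!big_split /=; apply: ler_sum => u _.
rewrite -!big_split /=; apply: ler_sum => v _; rewrite !inE.
have := w0 u v.
by case: (u \in A); case: (u \in B); case: (v \in A); case: (v \in B) => /=; lra.
Qed.

(** * Harmonic averages along a sequence of decisions *)

Definition rejected_fraction (R : realType) (a : pred nat) (k : nat) : R :=
  (\sum_(j < k) (~~ a j)%:R) / k%:R.

Lemma rejected_fraction_ge0 (R : realType) a k :
  0 <= rejected_fraction R a k.
Proof. by rewrite divr_ge0 ?ler0n // sumr_ge0. Qed.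

Lemma rejected_fraction_le1 (R : realType) a k :
  rejected_fraction R a k <= 1.
Proof.
rewrite /rejected_fraction; case: k => [|k]; first by rewrite big_ord0 mul0r.
rewrite ler_pdivrMr ?ltr0n // mul1r.
have -> : k.+1%:R = \sum_(j < k.+1) (1 : R) by rewrite sumr_const card_ord.
by apply: ler_sum => j _; case: (a j) => //=; exact: ler01.
Qed.

Lemma rejected_fractionS (R : realType) a k :
  rejected_fraction R a k.+1 = rejected_fraction R a k +
    ((~~ a k)%:R - rejected_fraction R a k) / k.+1%:R.
Proof.
rewrite /rejected_fraction big_ord_recr /=.
case: k => [|k]; first by rewrite big_ord0 !mul0r !add0r subr0.
have m0 : 0 < (k.+1%:R : R) by rewrite ltr0n.
rewrite [k.+2%:R]mulrS; move: k.+1%:R m0 => m m0.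
by field; rewrite !lt0r_neq0 // addr_gt0.
Qed.

(* The potential is half the squared rejected fraction y.  One step adds
   (y - a y - y^2)/k to it up to O(1/k^2), so that the gain a y / k is at most
   y(1 - y)/k <= 1/(4k) minus the increase of the potential.  The O(1/k^2)
   terms sum to at most 1 - 1/(2(K+1)) by telescoping. *)
Lemma harmonic_gain_le (R : realType) (a : pred nat) (K : nat) :
  \sum_(k < K) (a k.+1)%:R * rejected_fraction R a k.+1 / k.+2%:R <=
    4^-1 * (\sum_(k < K) k.+2%:R^-1) - rejected_fraction R a K.+1 ^+ 2 / 2
    + (1 - (2 * K.+1%:R)^-1).
Proof.
elim: K => [|K IH].
  rewrite !big_ord0 mulr1; have := rejected_fraction_ge0 R a 1.
  have := rejected_fraction_le1 R a 1; nra.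
rewrite !big_ord_recr /= (rejected_fractionS _ _ K.+1).
have y0 := rejected_fraction_ge0 R a K.+1.
have y1 := rejected_fraction_le1 R a K.+1.
set y := rejected_fraction R a K.+1 in IH y0 y1 *.
rewrite (invfM 2 (K.+1%:R)) (invfM 2 (K.+2%:R)) in IH *.
have r0 : 0 < (K.+2%:R^-1 : R) by rewrite invr_gt0 ltr0n.
have rE : (K.+1%:R^-1 : R) - K.+2%:R^-1 = K.+1%:R^-1 * K.+2%:R^-1.
  have m0 : 0 < (K.+1%:R : R) by rewrite ltr0n.
  rewrite [K.+2%:R]mulrS; move: K.+1%:R m0 => m m0.
  by field; rewrite !lt0r_neq0 // addr_gt0.
have rr : (K.+2%:R^-1 : R) <= K.+1%:R^-1.
  by rewrite lef_pV2 ?posrE ?ltr0n // ler_nat.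
set r := (K.+2%:R^-1 : R) in IH r0 rE rr *.
set t := (K.+1%:R^-1 : R) in IH rE rr *.
have rt : r ^+ 2 <= t - r by rewrite rE expr2 ler_wpM2r // ltW.
case: (a K.+1) => /=.
  have : 0 <= (1 - y ^+ 2) * r ^+ 2 by apply: mulr_ge0; nra.
  have : 0 <= (y - 2^-1) ^+ 2 * r by rewrite mulr_ge0 ?sqr_ge0 // ltW.
  nra.
have : 0 <= (1 - (1 - y) ^+ 2) * r ^+ 2 by apply: mulr_ge0; nra.
have : 0 <= (y - 2^-1) ^+ 2 * r by rewrite mulr_ge0 ?sqr_ge0 // ltW.
nra.
Qed.

(** * The hard instances and their values *)

Definition hard_weight (R : realType) (W : R) (n : nat) (u v : 'I_n) : R :=
  if (v < u)%N then W ^+ u / u%:R else 0.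

Definition hard (R : realType) (W : R) (n : nat) : {ffun {set 'I_n} -> R} :=
  dicut (hard_weight W (n := n)).

Lemma hard_is_dicut (R : realType) (W : R) n : 0 <= W -> is_dicut (hard W n).
Proof.
move=> W0; exists (hard_weight W (n := n)); split=> // u v.
by rewrite /hard_weight; case: ifP => // _; rewrite divr_ge0 ?exprn_ge0.
Qed.

(** An accepted [u] cuts exactly its arcs to rejected earlier elements. Describing the set by a
    predicate on [nat] lets one decision sequence serve instances of all sizes. *)
Lemma hardE (R : realType) (W : R) n (a : pred nat) :
  hard W n [set x : 'I_n | a x] =
    \sum_(u < n) (a u)%:R * (W ^+ u * rejected_fraction R a u).
Proof.
rewrite ffunE big_mkcond /=; apply: eq_bigr => u _; rewrite inE.
case: (a u); last by rewrite mul0r.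
rewrite mul1r /rejected_fraction mulrCA mulr_suml.
rewrite (big_ord_widen n (fun j => (~~ a j)%:R * (W ^+ u / u%:R))); last first.
  exact: ltnW.
rewrite big_mkcond [RHS]big_mkcond; apply: eq_bigr => v _; rewrite !inE.
by rewrite /hard_weight; case: (a v); case: (v < u)%N; rewrite ?mul0r ?mul1r.
Qed.

Lemma embed_pred m n (a : pred nat) :
  embed n [set y : 'I_m | a y] = [set x : 'I_n | (x < m)%N && a x].
Proof.
apply/setP => x; rewrite !inE; apply/existsP/andP => [[y]|[xm ax]].
  by rewrite inE => /andP[ay /eqP <-]; rewrite ltn_ord.
by exists (Ordinal xm); rewrite inE ax /=.
Qed.

Lemma set_ord_pred m (A : {set 'I_m}) :
  exists a : pred nat, A = [set y : 'I_m | a y].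
Proof.
exists (fun k => k \in map val (enum A)); apply/setP => y.
by rewrite inE mem_map ?mem_enum //; exact: val_inj.
Qed.

(* All arcs go to earlier elements, so a prefix of a hard instance is again a
   hard instance. *)
Lemma prefix_hard (R : realType) (W : R) m n : (m <= n)%N ->
  prefix_values (hard W n) m = hard W m.
Proof.
move=> mn; apply/ffunP => A; rewrite ffunE.
have [a ->] := set_ord_pred A; rewrite embed_pred.
rewrite (hardE W n (fun k => (k < m)%N && a k)) hardE.
rewrite (big_ord_widen n
  (fun u => (a u)%:R * (W ^+ u * rejected_fraction R a u)) mn).
rewrite [RHS]big_mkcond; apply: eq_bigr => u _.
case: ltnP => um /=; last by rewrite mul0r.
congr (_ * (_ * (_ / _))); apply: eq_bigr => j _.
by rewrite (ltn_trans (ltn_ord j) um).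
Qed.

(** Lower bound on the optimum: with only the last element accepted, its rejected fraction is 1. *)
Lemma hard_last (R : realType) (W : R) n :
  hard W n.+2 [set x : 'I_n.+2 | val x == n.+1] = W ^+ n.+1.
Proof.
rewrite (hardE W n.+2 (fun k => k == n.+1)) big_ord_recr /= big1 ?add0r.
  rewrite eqxx mul1r /rejected_fraction (eq_bigr (fun=> 1)).
    by rewrite sumr_const card_ord divff ?mulr1 // pnatr_eq0.
  by move=> j _; rewrite ltn_eqF.
by move=> j _; rewrite ltn_eqF // mul0r.
Qed.

Lemma sum_geometric_le (R : realType) (W : R) (b : nat -> R) n : 1 <= W ->
  (forall k, b k <= 1) -> (W - 1) * (\sum_(u < n) W ^+ u * b u) <= W ^+ n.
Proof.
move=> W1 b1; elim: n => [|n IH]; first by rewrite big_ord0 mulr0.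
rewrite big_ord_recr /= mulrDr exprS.
have : 0 <= (W - 1) * (W ^+ n * (1 - b n)).
  by rewrite !mulr_ge0 ?subr_ge0 ?exprn_ge0 // (le_trans ler01).
nra.
Qed.

(** The elements before the last contribute at most a geometric sum, which is below
    [W ^+ n / (W - 1)]. *)
Lemma hard_le (R : realType) (W : R) n (a : pred nat) : 1 < W ->
  hard W n.+1 [set x : 'I_n.+1 | a x] <=
    W ^+ n * ((a n)%:R * rejected_fraction R a n + (W - 1)^-1).
Proof.
move=> W1; have W0 : 0 < W - 1 by rewrite subr_gt0.
rewrite hardE big_ord_recr /= addrC mulrCA mulrDr lerD2l.
rewrite ler_pdivlMr // mulrC.
under eq_bigr do rewrite mulrCA.
apply: (sum_geometric_le (b := fun u => (a u)%:R * rejected_fraction R a u)).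
  exact: ltW.
move=> k; case: (a k); rewrite ?mul0r ?mul1r ?ler01 //.
exact: rejected_fraction_le1.
Qed.

(** * Runs of the algorithm *)

Section Solutions.
Variables (R : realType) (d : measure_display) (Omega : measurableType d).
Variable alg : online_algorithm R Omega.

(** The previous solution has finitely many possible values, so the event is a finite union of
    measurable ones. *)
Lemma solution_measurable n (f : {ffun {set 'I_n} -> R}) i (T : {set 'I_i}) :
  measurable ([set omega | solution alg f omega i = T]%classic : set Omega).
Proof.
elim: i T => [|i IH] T.
  rewrite [X in measurable X](_ : _ = setT); first exact: measurableT.
  by apply/seteqP; split=> // omega _; apply/setP => -[].
rewrite [X in measurable X](_ : _ = \bigcup_(S in [set: {set 'I_i}])
   ([set omega | solution alg f omega i = S] `&`
    [set omega | step alg (prefix_values f i.+1) S omega = T]))%classic.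
  apply: fin_bigcup_measurable => [|S _]; first exact: finite_finset.
  by apply: measurableI; [exact: IH|exact: step_measurable].
apply/seteqP; split=> [omega /= <-|omega [S _ [/= <- //]]].
by exists (solution alg f omega i).
Qed.

Lemma objective_measurable n (f : {ffun {set 'I_n} -> R}) :
  measurable_fun setT (fun omega => f (solution alg f omega n)).
Proof.
move=> _ Y _; rewrite setTI.
rewrite [X in measurable X](_ : _ = \bigcup_(S in [set S | Y (f S)])
   [set omega | solution alg f omega n = S])%classic.
  apply: fin_bigcup_measurable => [|S _]; first exact: finite_finset.
  exact: solution_measurable.
apply/seteqP; split=> [omega Yf|omega [S YS /= SE]] /=; last by rewrite SE.
by exists (solution alg f omega n).
Qed.

Variables (C : forall n, {ffun {set 'I_n} -> R} -> Prop) (W : R).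
Hypothesis hardC : forall n, C (hard W n).

(** The decision on element [k] is read off the instance in which it arrives last, hence does not
    depend on the final length. *)
Definition accepts (omega : Omega) (k : nat) : bool :=
  ord_max \in solution alg (hard W k.+1) omega k.+1.

Lemma solution_prefix n m omega : (m <= n)%N ->
  solution alg (hard W n) omega m = solution alg (hard W m) omega m.
Proof.
(* Two arbitrary lengths are compared, so that the induction can run on the number of arrivals
   alone. *)
have E k l i : (i <= k)%N -> (i <= l)%N ->
    solution alg (hard W k) omega i = solution alg (hard W l) omega i.
  elim: i => [//|i IH] ik il /=.
  by rewrite IH ?(ltnW ik) ?(ltnW il) // !prefix_hard.
by move=> mn; apply: E.
Qed.

(** Earlier elements can be neither added later ([sub]) nor removed ([keep]); for the last one the
    claim is the definition of [accepts]. *)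
Lemma hard_solution omega n : no_preemption C alg ->
  solution alg (hard W n) omega n = [set x : 'I_n | accepts omega x].
Proof.
move=> np; elim: n => [|n IH]; first by apply/setP => -[].
have E := solution_prefix omega (leqnSn n); rewrite IH in E.
have keep := np _ _ (hardC n.+1) omega n (ltnSn n).
have sub : solution alg (hard W n.+1) omega n.+1 \subset
    embed n.+1 (solution alg (hard W n.+1) omega n) :|: [set ord_max].
  exact: step_sub.
rewrite E embed_pred in keep sub.
apply/setP => x; rewrite inE; have [xn|nx] := ltnP x n.
  apply/idP/idP => [/(fintype.subsetP sub)|ax].
    rewrite !inE => /orP[/andP[]//|/eqP xE].
    by rewrite xE ltnn in xn.
  by apply: (fintype.subsetP keep); rewrite inE xn.
have -> : x = ord_max by apply/val_inj/eqP; rewrite eqn_leq -ltnS ltn_ord.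
by [].
Qed.

End Solutions.

(** * From pointwise bounds to expectations *)

Lemma sum_le_of_expectation (R : realType) (d : measure_display)
    (Omega : measurableType d) (P : probability Omega R) (K : nat)
    (Y : 'I_K -> Omega -> R) (c b : 'I_K -> R) (B : R) :
  (forall k, measurable_fun setT (Y k)) -> (forall k omega, 0 <= Y k omega) ->
  (forall k, 0 <= c k) -> (forall k, ((b k)%:E <= 'E_P[Y k])%E) ->
  (forall omega, \sum_k c k * Y k omega <= B) ->
  \sum_k c k * b k <= B.
Proof.
move=> mY Y0 c0 bY cYB; rewrite -lee_fin -sumEFin.
apply: (@le_trans _ _ (\sum_(k < K) (c k)%:E * 'E_P[Y k])%E).
  by apply: lee_sum => k _; rewrite EFinM lee_wpmul2l ?lee_fin.
have mEY k : measurable_fun setT (EFin \o Y k) by exact/measurable_EFinP.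
have EY k : ((c k)%:E * 'E_P[Y k] = \int[P]_w ((c k)%:E * (Y k w)%:E))%E.
  have Yk0 w : setT w -> (0 <= (Y k w)%:E)%E by rewrite lee_fin.
  by rewrite unlock (ge0_integralZl_EFin _ measurableT Yk0 (mEY k) (c0 k)).
rewrite (eq_bigr _ (fun k _ => EY k)).
(* Nonnegativity permits exchanging sum and integral; the pointwise bound by [B] then integrates to
   [B], as [P] has mass 1. *)
rewrite -ge0_integral_sum //; last 2 first.
- by move=> k; apply: measurable_funeM; exact: mEY.
- by move=> k w _; rewrite -EFinM lee_fin mulr_ge0.
have -> : B%:E = (\int[P]_w (cst B w)%:E)%E.
  by have := expectation_cst P B; rewrite unlock.
apply: ge0_le_integral => //.
- by move=> w _; apply: sume_ge0 => k _; rewrite -EFinM lee_fin mulr_ge0.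
- by apply: emeasurable_sum => k; apply: measurable_funeM; exact: mEY.
- exact/measurable_EFinP.
- by move=> w _ /=; under eq_bigr do rewrite -EFinM; rewrite sumEFin lee_fin.
Qed.

Lemma harmonic_sum_unbounded (R : realType) (M : R) :
  exists K, M < \sum_(k < K) k.+2%:R^-1.
Proof.
apply: contrapT => /forallNP H.
apply: (@dvg_harmonic R); apply: nondecreasing_is_cvgn.
  by apply: nondecreasing_series => k _ _; exact: harmonic_ge0.
(* The extra 1 is the first harmonic term, missing from the sums that start at 1/2. *)
exists (1 + M) => _ [K _ <-]; rewrite /series /=.
apply: (@le_trans _ _ (\sum_(0 <= k < K.+1) (harmonic k : R))).
  by rewrite big_nat_recr //= lerDl invr_ge0.
rewrite big_nat_recl //= invr1 lerD2l big_mkord.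
by have /negP := H K; rewrite -leNgt.
Qed.

(** Only hard instances are used, so any class [C] containing the directed cuts will do; this treats
    both claims of the theorem at once. *)
Lemma no_preemption_not_competitive (R : realType) (eps : R)
    (d : measure_display) (Omega : measurableType d) (P : probability Omega R)
    (C : forall n, {ffun {set 'I_n} -> R} -> Prop)
    (alg : online_algorithm R Omega) :
  0 < eps -> (forall n (f : {ffun {set 'I_n} -> R}), is_dicut f -> C n f) ->
  no_preemption C alg -> ~ competitive P C (4^-1 + eps) alg.
Proof.
move=> eps0 dicutC np comp.
(* Chosen so that the earlier elements cost only half of the slack [eps]. *)
pose W : R := 1 + 2 / eps.
have W1 : 1 < W by rewrite ltrDl divr_gt0.
have W0 : 0 < W by rewrite (lt_trans ltr01).
have WE : (W - 1)^-1 = eps / 2 by rewrite /W addrC addKr invf_div.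
have Wdicut n : is_dicut (hard W n) by apply: hard_is_dicut; exact: ltW.
have hardC n : C n (hard W n) by exact: dicutC.
(* The other half, [eps / 2] times the harmonic sum, must exceed the additive constant 1 left by
   [harmonic_gain_le]. *)
have [K HK] := harmonic_sum_unbounded (2 / eps).
pose Y (k : 'I_K) omega :=
  hard W k.+2 (solution alg (hard W k.+2) omega k.+2).
(* Instance [k] has last element [k.+1]: its value is normalised by the optimum bound [W ^+ k.+1]
   and given harmonic weight. *)
pose c (k : 'I_K) : R := (W ^+ k.+1)^-1 / k.+2%:R.
have c0 k : 0 <= c k by rewrite divr_ge0 ?invr_ge0 ?exprn_ge0 ?ler0n // ltW.
have Wn0 k : W ^+ k != 0 by rewrite expf_neq0 // gt_eqF.
have : \sum_k c k * ((4^-1 + eps) * W ^+ k.+1) <=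
    1 + (4^-1 + eps / 2) * \sum_(k < K) k.+2%:R^-1.
  apply: (sum_le_of_expectation (P := P) (Y := Y)) => //.
  - by move=> k; exact: objective_measurable.
  - move=> k omega.
    by have [+ _] := is_dicut_nonneg_submodular (Wdicut k.+2); apply.
  - move=> k; apply: le_trans (comp _ _ (hardC k.+2)).
    rewrite lee_fin ler_wpM2l ?addr_ge0 ?invr_ge0 ?(ltW eps0) //.
    by rewrite -hard_last; exact: le_bigmax.
  - move=> omega; pose a := accepts alg W omega.
    apply: (@le_trans _ _ (\sum_(k < K)
      ((a k.+1)%:R * rejected_fraction R a k.+1 / k.+2%:R +
       eps / 2 / k.+2%:R))).
      apply: ler_sum => k _.
      rewrite /Y (hard_solution hardC) // -/a /c.
      apply: le_trans (ler_wpM2l (c0 k) (hard_le k.+1 a W1)) _.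
      by rewrite /c WE -mulrDl mulrAC mulKf.
    rewrite big_split /= -mulr_sumr.
    have := harmonic_gain_le R a K.
    have : 0 <= (2 * K.+1%:R)^-1 :> R by rewrite invr_ge0 mulr_ge0.
    have := sqr_ge0 (rejected_fraction R a K.+1).
    rewrite [(4^-1 + _) * _]mulrDl; move: (2 * _)^-1 => r.
    move: (_ ^+ 2) (eps / 2 * _) (4^-1 * _) (\sum_(_ < K) _) => q e h g.
    lra.
rewrite (eq_bigr (fun k : 'I_K => (4^-1 + eps) * k.+2%:R^-1)); last first.
  by move=> k _; rewrite /c mulrCA mulrAC mulVf ?mul1r.
rewrite -mulr_sumr; rewrite ltr_pdivrMr // in HK.
nra.
Qed.

Theorem theorem1p1 (R : realType) (eps : R) (eps_gt0 : 0 < eps)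
    (d : measure_display) (Omega : measurableType d) (P : probability Omega R)
    (alg : online_algorithm R Omega) :
  (no_preemption (@nonneg_submodular R) alg ->
     ~ competitive P (@nonneg_submodular R) (4^-1 + eps) alg) /\
  (no_preemption (@is_dicut R) alg ->
     ~ competitive P (@is_dicut R) (4^-1 + eps) alg).
Proof.
split; apply: no_preemption_not_competitive => // n f.
exact: is_dicut_nonneg_submodular.
Qed.
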